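(* Let $n \in \mathbb{N}$, $k \in \mathbb{N}\setminus\{0\}$ and let $$\delta = \begin{cases} 1 & \text{if } n = 0,\\ k & \text{if } n \neq 0 \text{ and } k \leq n,\\ k-1 & \text{if } n \neq 0 \text{ and } k > n.\end{cases}$$ Then $\{(2^k+1)\cdot 2^{n+i} - (2^k-1) : i \in \{0,1,\dots,n+\delta\}\}$ is a minimal system of generators of $GT(n,k)$.
   Context: $\mathbb{N}$ is the set of nonnegative integers. For a nonempty $A\subseteq\mathbb{N}$, $\langle A\rangle$ denotes the submonoid of $(\mathbb{N},+)$ generated by $A$. $GT(n,k) = \langle \{(2^k+1)\cdot 2^{n+i} - (2^k-1) : i \in \mathbb{N}\}\rangle$ (the generalized Thabit numerical semigroup). A set $A$ is a system of generators of $S$ if $S=\langle A\rangle$; it is a minimal system of generators of $S$ if moreover $S\neq\langle X\rangle$ for every proper subset $X\subsetneq A$. *)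

(* Defs.v *)
From mathcomp Require Import all_boot.
From mathcomp Require Import boolp classical_sets.

Set Implicit Arguments.
Unset Strict Implicit.
Unset Printing Implicit Defensive.

Local Open Scope classical_set_scope.
Local Open Scope nat_scope.

Definition is_submonoid (M : set nat) : Prop :=
  M 0 /\ (forall x y : nat, M x -> M y -> M (x + y)).

(* Also defined for A empty, in which case it is {0}. *)
Definition submonoid_gen (A : set nat) : set nat := smallest is_submonoid A.

Definition generating_system (A S : set nat) : Prop := S = submonoid_gen A.

Definition minimal_generating_system (A S : set nat) : Prop :=
  generating_system A S /\
  (forall X : set nat, X `<` A -> S <> submonoid_gen X).

(* The truncated subtractions never truncate: 1 <= 2 ^ k, and
   2 ^ k - 1 <= (2 ^ k + 1) * 2 ^ (n + i). *)
Definition thabit (n k i : nat) : nat :=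
  (2 ^ k + 1) * 2 ^ (n + i) - (2 ^ k - 1).

Definition GT (n k : nat) : set nat := submonoid_gen (range (thabit n k)).

Definition delta (n k : nat) : nat :=
  if n == 0 then 1 else if k <= n then k else k - 1.

(* Main.v *)
(** Write [c = 2 ^ k - 1], [s i = thabit n k i] and [s0 = s 0].  Then
    [s i + c = 2 ^ i * (s0 + c)] with [s0 + c] coprime to [c], and [n + delta]
    is the exponent [e] with [2 ^ e <= s0 < 2 ^ (e + 1)].

    A relation [s i = \sum_(j <- l) s j] forces [size l = 1 + t (s0 + c)] and
    [\sum_(j <- l) 2 ^ j = 2 ^ i + t c] for some [t].  As the size is at most
    the sum of powers of two, [1 + t s0 <= 2 ^ i]; so [t = 0] when [i <= e],
    and the relation is trivial.

    For [i = e + 1], spending [t = 1] on the first two generators gives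
    [s i = (2 ^ k + 2 s0 + 1 - 2 ^ i) s0 + (2 ^ i - 1 - s0) s 1].  Since
    [s (i + 1) = 2 s i + c], the monoid is then stable under
    [x |-> 2 x + c] on nonzero elements and contains every [s i]. *)

Require Import Defs.
From mathcomp Require Import all_boot.
From mathcomp Require Import boolp classical_sets.
From mathcomp Require Import zify.

Local Open Scope classical_set_scope.
Local Open Scope nat_scope.

Lemma submonoid_gen_submonoid (A : set nat) : is_submonoid (submonoid_gen A).
Proof.
split=> [M [[M0 _] _] //|x y Ax Ay M [sM AM]].
by apply: sM.2; [apply: Ax|apply: Ay].
Qed.

Lemma sub_submonoid_gen (A : set nat) : A `<=` submonoid_gen A.
Proof. by move=> x Ax M [_ AM]; apply: AM. Qed.

Lemma submonoid_gen_sub (A M : set nat) :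
  is_submonoid M -> A `<=` M -> submonoid_gen A `<=` M.
Proof. by move=> sM AM x; apply. Qed.

Lemma submonoid_gen_mul (A : set nat) (m x : nat) :
  submonoid_gen A x -> submonoid_gen A (m * x).
Proof.
have [A0 AD] := submonoid_gen_submonoid A.
by move=> Ax; elim: m => [//|m IHm]; rewrite mulSn; apply: AD.
Qed.

(** The list records indices rather than values, so that the powers [2 ^ j] can be summed over the
    same list. *)
Lemma submonoid_gen_sum (I : eqType) (f : I -> nat) (X : set nat) (x : nat) :
  X `<=` range f -> submonoid_gen X x ->
  exists2 l : seq I, {in l, forall j, X (f j)} & x = \sum_(j <- l) f j.
Proof.
move=> Xf; move: x; apply: submonoid_gen_sub; first split.
- by exists [::]; rewrite ?big_nil.
- move=> _ _ [l Xl ->] [l' Xl' ->].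
  exists (l ++ l'); last by rewrite big_cat.
  by move=> j; rewrite mem_cat => /orP[/Xl|/Xl'].
- move=> y Xy; have [j _ fj] := Xf y Xy; exists [:: j]; last by rewrite big_seq1.
  by move=> i; rewrite inE => /eqP->; rewrite fj.
Qed.

(* Adding [b] to [a] makes [2 * a + c] into [(2 * a + c) + 2 * b], so stability
   needs to be checked on generators only. *)
Lemma submonoid_gen_affine (A : set nat) (c x : nat) :
  (forall a, A a -> submonoid_gen A (2 * a + c)) ->
  submonoid_gen A x -> x <> 0 -> submonoid_gen A (2 * x + c).
Proof.
have [A0 AD] := submonoid_gen_submonoid A.
move=> Ac Ax.
(* The induction carries membership along with stability, because the case of [x + y] needs [2 * y]
   in the monoid. *)
suff [_] : (submonoid_gen A `&`
    [set y | y <> 0 -> submonoid_gen A (2 * y + c)]) x by [].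
move: x Ax; apply: submonoid_gen_sub; first split.
- by split.
- move=> x y [Ax IHx] [Ay IHy]; split; first exact: AD.
  case: (eqVneq x 0) => [->|/eqP/IHx Ac' _]; first by rewrite add0n.
  have -> : 2 * (x + y) + c = (2 * x + c) + 2 * y by lia.
  by apply: AD => //; apply: submonoid_gen_mul.
- by move=> x Ax; split=> [|_]; [apply: sub_submonoid_gen|apply: Ac].
Qed.

Lemma thabit_addc (n k i : nat) :
  thabit n k i + (2 ^ k - 1) = (2 ^ k + 1) * 2 ^ n * 2 ^ i.
Proof.
have := expn_gt0 2 n; have := expn_gt0 2 i.
by rewrite /thabit expnD mulnA; nia.
Qed.

Lemma thabit_gt0 (n k i : nat) : 0 < thabit n k i.
Proof.
have := expn_gt0 2 n; have := expn_gt0 2 i; have := expn_gt0 2 k.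
by have := thabit_addc n k i; nia.
Qed.

Lemma thabit_rec (n k i : nat) :
  thabit n k i.+1 = 2 * thabit n k i + (2 ^ k - 1).
Proof.
have := thabit_addc n k i; have := thabit_addc n k i.+1.
by rewrite expnS; lia.
Qed.

(** Over the integers [s0 = 2 ^ (n + k) + (2 ^ n + 1 - 2 ^ k)]. For [n <> 0] the sign of the
    correction decides between the exponents [n + k] and [n + k - 1]; for [n = 0] it leaves
    [s0 = 2]. *)
Lemma delta_bounds (n k : nat) : k <> 0 ->
  2 ^ (n + delta n k) <= thabit n k 0 < 2 ^ (n + delta n k).+1.
Proof.
move=> hk; have := thabit_addc n k 0; rewrite expn0 muln1 expnS /delta.
have k2 : 2 <= 2 ^ k by rewrite -{1}(expn1 2) leq_exp2l //; lia.
have [->|n0] := eqVneq n 0; first by rewrite expn0 add0n expn1; lia.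
have n2 : 2 <= 2 ^ n by rewrite -{1}(expn1 2) leq_exp2l //; lia.
case: (leqP k n) => kn.
  have : 2 ^ k <= 2 ^ n by rewrite leq_exp2l.
  by rewrite expnD; nia.
have : 2 * 2 ^ n <= 2 ^ k by rewrite -expnS leq_exp2l.
have : 2 * 2 ^ (k - 1) = 2 ^ k by rewrite -expnS; congr (2 ^ _); lia.
by rewrite expnD; nia.
Qed.

Lemma thabit_sum (n k : nat) (l : seq nat) :
  \sum_(j <- l) thabit n k j + size l * (2 ^ k - 1) =
  (2 ^ k + 1) * 2 ^ n * \sum_(j <- l) 2 ^ j.
Proof.
rewrite big_distrr -sum1_size big_distrl -big_split /=.
by apply: eq_bigr => j _; rewrite mul1n thabit_addc.
Qed.

Lemma size_le_sum_exp2 (l : seq nat) : size l <= \sum_(j <- l) 2 ^ j.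
Proof. by rewrite -sum1_size leq_sum // => j _; rewrite expn_gt0. Qed.

(** As [2 ^ k + 1 = 2 + c], both factors are coprime to [c] once [c] is odd. *)
Lemma coprime_thabit (n k : nat) : k <> 0 ->
  coprime ((2 ^ k + 1) * 2 ^ n) (2 ^ k - 1).
Proof.
move=> hk.
have k2 : 2 <= 2 ^ k by rewrite -{1}(expn1 2) leq_exp2l //; lia.
have odd_c : coprime 2 (2 ^ k - 1).
  by rewrite coprime2n oddB ?oddX /=; [case: k hk {k2}|lia].
rewrite coprimeMl coprimeXl // andbT.
have -> : 2 ^ k + 1 = 2 + (2 ^ k - 1) by lia.
by rewrite /coprime gcdnC gcdnDr gcdnC.
Qed.

Lemma thabit_irreducible (n k i : nat) (l : seq nat) : k <> 0 ->
  2 ^ i <= thabit n k 0 -> thabit n k i = \sum_(j <- l) thabit n k j ->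
  l = [:: i].
Proof.
move=> hk le_i def_i.
have := thabit_sum n k l; rewrite -def_i.
have := thabit_addc n k i; have := thabit_addc n k 0; rewrite expn0 muln1.
have := size_le_sum_exp2 l; have := coprime_thabit n k hk.
have := thabit_gt0 n k 0; have := thabit_gt0 n k i; have := expn_gt0 2 k.
move: le_i.
set a := (2 ^ k + 1) * 2 ^ n; set c := 2 ^ k - 1; set s0 := thabit n k 0.
set N := size l; set P := \sum_(j <- l) 2 ^ j.
move=> le_i k0 si0 s0_gt0 cop le_NP def_s0 def_si def_sum.
have N0 : 0 < N.
  have : l <> [::] by move=> l0; rewrite l0 big_nil in def_i; lia.
  by rewrite /N; case: (l).
have def_Nc : (N - 1) * c = a * (P - 2 ^ i).
  by rewrite mulnBl mulnBr; lia.
(* From here on [P - 2 ^ i] is a true difference. *)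
have le_P : 2 ^ i <= P by nia.
have /dvdnP[t def_N] : a %| N - 1.
  by rewrite -(Gauss_dvdl _ cop) def_Nc dvdn_mulr.
have def_P : P - 2 ^ i = t * c.
  by apply/eqP; rewrite -(eqn_pmul2l (m := a)) -?def_Nc ?def_N; [apply/eqP|]; nia.
have t0 : t = 0 by nia.
have {}def_P : P = 2 ^ i by nia.
have {}def_N : size l = 1 by rewrite -/N; nia.
case: l def_N @P def_P {def_i N N0 le_NP def_sum le_P def_Nc}
  => [//|j [|//]] _ P.
by rewrite /P big_seq1 => /eqP; rewrite eqn_exp2l // => /eqP->.
Qed.

(** The coefficients [u], [v] solve [u + v = 1 + (s0 + c)] and [u + 2 * v = 2 ^ j + c], the
    conditions on size and powers for [t = 1]; the hypothesis keeps both nonnegative. *)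
Lemma thabit_next (n k j : nat) :
  thabit n k 0 < 2 ^ j <= 2 ^ k + 1 + 2 * thabit n k 0 ->
  thabit n k j = (2 ^ k + 1 + 2 * thabit n k 0 - 2 ^ j) * thabit n k 0 +
                 (2 ^ j - 1 - thabit n k 0) * thabit n k 1.
Proof.
move=> /andP[]; rewrite thabit_rec.
have := thabit_addc n k j; have := thabit_addc n k 0; rewrite expn0 muln1 => <-.
have := expn_gt0 2 k.
move: (2 ^ k) (2 ^ j) (thabit n k 0) (thabit n k j) => [//|c] q s0 sj _ /=.
rewrite addn1 subn1 /= => def_sj lt_q le_q.
have [x def_q] : {x | q = s0 + 1 + x} by exists (q - s0 - 1); lia.
have [y def_y] : {y | c.+2 + 2 * s0 = q + y}.
  by exists (c.+2 + 2 * s0 - q); lia.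
rewrite def_y addKn.
have -> : q - 1 - s0 = x by lia.
by nia.
Qed.

Lemma thabit_in_gen (n k i : nat) : k <> 0 ->
  submonoid_gen
    [set thabit n k i | i in [set i : nat | i <= n + delta n k]]
    (thabit n k i).
Proof.
move=> hk; set A := (X in submonoid_gen X _); set e := n + delta n k.
have genA j : j <= e -> submonoid_gen A (thabit n k j).
  by move=> le_j; apply: sub_submonoid_gen; exists j.
have /andP[le_s0 lt_s0] := delta_bounds n k hk; rewrite -/e in le_s0 lt_s0.
(* The relation for [s (e + 1)] uses [s 1], which must be among the generators. *)
have e_gt0 : 0 < e.
  have := thabit_addc n k 0; rewrite expn0 muln1.
  have k2 : 2 <= 2 ^ k by rewrite -{1}(expn1 2) leq_exp2l //; lia.
  move=> def_s0; have := expn_gt0 2 n => n2; rewrite lt0n; apply/eqP => e0.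
  by move: lt_s0; rewrite e0 expn1; nia.
have genA_next : submonoid_gen A (thabit n k e.+1).
  rewrite thabit_next; last by rewrite lt_s0 /= expnS; lia.
  by apply: (submonoid_gen_submonoid A).2; apply: submonoid_gen_mul; apply: genA.
elim: i => [|i IHi]; first exact: genA.
rewrite thabit_rec; apply: submonoid_gen_affine => //; last first.
  by apply/eqP; rewrite -lt0n thabit_gt0.
(* The image of [s j] is [s (j + 1)]: again a generator, except for [j = e], where [genA_next]
   applies. *)
move=> _ [j /= le_j <-]; rewrite -thabit_rec.
by move: le_j; rewrite leq_eqVlt => /orP[/eqP->|]; [|apply: genA].
Qed.

Theorem theorem3p6 (n k : nat) (hk : k <> 0) :
  minimal_generating_system
    [set thabit n k i | i in [set i : nat | i <= n + delta n k]]
    (GT n k).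
Proof.
split.
  apply/seteqP; split; apply: submonoid_gen_sub;
    try exact: submonoid_gen_submonoid.
    by move=> _ [i _ <-]; apply: thabit_in_gen.
  by move=> _ [i _ <-]; apply: sub_submonoid_gen; exists i.
(* Each [s i] with [i <= e] is a sum of elements of [X]; irreducibility reduces the sum to [s i]
   itself, so [X] is not a proper subset. *)
move=> X [XA nAX] eq_gen; apply: nAX => _ [i /= le_i <-].
have : GT n k (thabit n k i) by apply: sub_submonoid_gen; exists i.
rewrite eq_gen => /(submonoid_gen_sum nat (thabit n k))[|l Xl def_i].
  by move=> _ /XA[j _ <-]; exists j.
have le_s0 : 2 ^ i <= thabit n k 0.
  have /andP[le_e _] := delta_bounds n k hk.
  by apply: leq_trans le_e; rewrite leq_exp2l.
apply: Xl; rewrite (thabit_irreducible n k i l) ?inE //.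
Qed.
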